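(* Let $(G,d)$ be a balanced, strongly connected graph with absorption on the vertex set $V=\{1,\dots,n\}$, with graph Laplacian $L$ and absorption inverse $L^d$. Let $K=\max_i L^d_{ii}$ and define $R$ on $V\times V$ by $$R(j,i)=\begin{cases}K-L^d_{ij}, & i\ne j,\\ 0, & i=j.\end{cases}$$ Then $R$ is a directed metric on $V$; that is, $R$ takes nonnegative real values, $R(i,i)=0$ for all $i\in V$, and $R(j,k)\le R(j,i)+R(i,k)$ for all $i,j,k\in V$.
   Context: $G$ is a strongly connected, weighted, directed graph on $V=\{1,\dots,n\}$ with weighted adjacency matrix $A=(a_{ij})\in\mathbb{R}^{n\times n}$, $a_{ij}\ge 0$, where $a_{ij}$ is the weight of the edge from $j$ to $i$ (with $a_{ij}>0$ exactly when that edge is present). $G$ is balanced if for each vertex the sum of incoming edge weights equals the sum of outgoing edge weights: $\sum_j a_{ij}=\sum_j a_{ji}$ for all $i$. The outdegrees are $w_i=\sum_{j=1}^n a_{ji}$, $W=\mathrm{diag}\{w\}$, and the graph Laplacian is $L=W-A$. The vector $d=(d_1,\dots,d_n)^T$ has all $d_i>0$ (absorption rates), and $D=\mathrm{diag}\{d\}$. Let $N_{1,0}=\{x\in\mathbb{R}^n: Dx\in\mathrm{range}\,L\}$ and $R_{1,0}=\{Dx: x\in\ker L\}$. The absorption inverse $L^d$ of $L$ with respect to $d$ is the (unique) matrix $X\in\mathbb{R}^{n\times n}$ with $XLy=y$ for all $y\in N_{1,0}$ and $Xy=0$ for all $y\in R_{1,0}$. A directed metric on a set $X$ is a function $f:X\times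 X\to\mathbb{R}_{\ge0}$ with $f(x,x)=0$ for all $x$ and $f(x,y)\le f(x,z)+f(z,y)$ for all $x,y,z\in X$ (no symmetry required). *)

(* Defs.v *)
From HB Require Import structures.
From mathcomp Require Import all_boot all_order all_algebra.

Set Implicit Arguments.
Unset Strict Implicit.
Unset Printing Implicit Defensive.

Import Order.TTheory GRing.Theory Num.Theory.
Local Open Scope ring_scope.

(* A weighted digraph on 'I_n is given by its weighted adjacency matrix A,
   where A i j is the weight of the edge from j to i: rows are heads. *)

Definition nonneg_weights (F : realFieldType) n (A : 'M[F]_n) : Prop :=
  forall i j, 0 <= A i j.

Definition edge (F : realFieldType) n (A : 'M[F]_n) : rel 'I_n :=
  fun j i => 0 < A i j.

Definition strongly_connected (F : realFieldType) n (A : 'M[F]_n) : Prop :=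
  forall i j, connect (edge A) i j.

Definition balanced (F : realFieldType) n (A : 'M[F]_n) : Prop :=
  forall i, \sum_j A i j = \sum_j A j i.

Definition outdegree (F : realFieldType) n (A : 'M[F]_n) : 'rV[F]_n :=
  \row_i \sum_j A j i.

Definition laplacian (F : realFieldType) n (A : 'M[F]_n) : 'M[F]_n :=
  diag_mx (outdegree A) - A.

(* The vector d of absorption rates is a row only because diag_mx expects one;
   all matrices act on column vectors from the left. *)

(* N_{1,0} = { x | D x \in range L } *)
Definition in_N10 (F : realFieldType) n (L : 'M[F]_n) (d : 'rV[F]_n)
    (x : 'cV[F]_n) : Prop :=
  exists z : 'cV[F]_n, diag_mx d *m x = L *m z.

(* R_{1,0} = { D x | x \in ker L } *)
Definition in_R10 (F : realFieldType) n (L : 'M[F]_n) (d : 'rV[F]_n)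
    (y : 'cV[F]_n) : Prop :=
  exists2 x : 'cV[F]_n, L *m x = 0 & y = diag_mx d *m x.

(* X = L^d. For the Laplacian of a strongly connected graph and d > 0 there is
   exactly one such X. *)
Definition is_absorption_inverse (F : realFieldType) n (L : 'M[F]_n)
    (d : 'rV[F]_n) (X : 'M[F]_n) : Prop :=
  (forall y : 'cV[F]_n, in_N10 L d y -> X *m L *m y = y) /\
  (forall y : 'cV[F]_n, in_R10 L d y -> X *m y = 0).

(* The seed of the iterated max is itself a diagonal entry, so this is the
   maximum of the diagonal even if all its entries are negative. *)
Definition max_diag (F : realFieldType) n (X : 'M[F]_n.+1) : F :=
  \big[Num.max/X ord0 ord0]_i X i i.

(* Transposed indices: the value at (j, i) involves the entry X i j. *)
Definition absorption_distance (F : realFieldType) n (X : 'M[F]_n.+1)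
    (j i : 'I_n.+1) : F :=
  if i == j then 0 else max_diag X - X i j.

Definition directed_metric (F : realFieldType) (T : Type) (f : T -> T -> F) :
    Prop :=
  [/\ forall x y, 0 <= f x y,
      forall x, f x x = 0
    & forall x y z, f x y <= f x z + f z y].

(* Main.v *)
(* Write X for the absorption inverse and s for the sum of the d_i.  By the
   maximum principle the left kernel of L consists of the constant rows, so
   range L is the set of vectors with sum 0; as L kills the constants, this
   gives (X L)_{km} = [k = m] - d_m / s.  The maximum principle applied to the
   row -X_i shows X_ij <= X_ii <= K, and applied to the row X_k - X_i, whose
   image under L is e_k - e_i, it shows X_ki - X_ii <= X_kj - X_ij, which is
   the triangle inequality. *)
Require Import Defs.
From HB Require Import structures.
From mathcomp Require Import all_boot all_order all_algebra.
From mathcomp Require Import lra.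

Set Implicit Arguments.
Unset Strict Implicit.
Unset Printing Implicit Defensive.

Import Order.TTheory GRing.Theory Num.Theory.
Local Open Scope ring_scope.

Lemma mulmx_laplacianE (F : realFieldType) n (A : 'M[F]_n) (u : 'rV[F]_n) m :
  (u *m laplacian A) 0 m = \sum_p A p m * (u 0 m - u 0 p).
Proof.
rewrite /laplacian mulmxBr mul_mx_diag !mxE mulr_sumr -sumrB.
by apply: eq_bigr => p _; rewrite mulrBr [u 0 m * _]mulrC [u 0 p * _]mulrC.
Qed.

(** Balance turns the column sums on the diagonal of the Laplacian into row sums. *)
Lemma laplacian_mul_const (F : realFieldType) n (A : 'M[F]_n) (c : F) :
  balanced A -> laplacian A *m const_mx c = 0 :> 'cV_n.
Proof.
move=> balA; apply/matrixP => i j.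
rewrite /laplacian mulmxBl mul_diag_mx !mxE -balA mulr_suml -sumrB.
by rewrite big1 // => p _; rewrite !mxE subrr.
Qed.

(* Minimality propagates along the edges leaving any minimizer other than i,
   so a path from a minimizer to i carries it to i. *)
Lemma laplacian_min (F : realFieldType) n (A : 'M[F]_n) (u : 'rV[F]_n) i :
  nonneg_weights A -> strongly_connected A ->
  (forall m, m != i -> 0 <= (u *m laplacian A) 0 m) ->
  forall j, u 0 i <= u 0 j.
Proof.
move=> A_ge0 connA uL_ge0.
have [m _ m_min] := @arg_minP _ _ _ i xpredT (u 0) isT.
have [p] := connectP (connA m i).
elim: p m m_min => [|q p IHp] x x_min /=.
  by move=> _ -> j; apply: x_min.
have [x_eq_i _ _ j|x_neq_i /andP[Aqx_gt0 path_p] last_p] := eqVneq x i.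
  by rewrite -x_eq_i; apply: x_min.
apply: IHp path_p last_p => j _; apply: le_trans (x_min j isT).
(* Since [x] is a minimizer, no term of this sum is positive; as the sum is nonnegative, the term of
   [q] cannot be negative either. *)
have := uL_ge0 x x_neq_i; rewrite mulmx_laplacianE (bigD1 q) //=.
have rest_le0 : \sum_(p' < n | p' != q) A p' x * (u 0 x - u 0 p') <= 0.
  by apply: sumr_le0 => k _; rewrite mulr_ge0_le0 ?subr_le0 ?x_min.
move/le_trans/(_ (lerD (lexx _) rest_le0)).
by rewrite addr0 pmulr_rge0 // subr_ge0.
Qed.

(** By duality, it suffices that every row killing [L] also kills [v]; such rows are constant. *)
Lemma range_laplacian (F : realFieldType) n (A : 'M[F]_n) (v : 'cV[F]_n) :
  nonneg_weights A -> strongly_connected A ->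
  \sum_i v i 0 = 0 -> exists z : 'cV_n, v = laplacian A *m z.
Proof.
move=> A_ge0 connA sum_v; set L := laplacian A.
suff /submxP[z vz] : (v^T <= L^T)%MS.
  by exists z^T; rewrite -[v]trmxK vz trmx_mul trmxK.
rewrite submxE; apply/eqP/matrixP => i k; rewrite ord1 {i} [RHS]mxE.
pose u := row k (cokermx L^T)^T.
have uL0 : u *m L = 0.
  by rewrite -row_mul -[X in _ *m X]trmxK -trmx_mul mulmx_coker trmx0 row0.
(* As [u *m L] vanishes everywhere, any index may serve as the exceptional one in
   [laplacian_min]. *)
have u_const i j : u 0 i = u 0 j.
  by apply/eqP; rewrite eq_le !(laplacian_min A_ge0 connA) // => m _;
     rewrite uL0 mxE.
transitivity (\sum_j v j 0 * u 0 k).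
  by rewrite mxE; apply: eq_bigr => j _; rewrite -(u_const j) !mxE.
by rewrite -mulr_suml sum_v mul0r.
Qed.

Lemma absorption_inverse_mul_laplacian (F : realFieldType) n (A : 'M[F]_n)
    (d : 'rV[F]_n) (X : 'M[F]_n) :
  nonneg_weights A -> strongly_connected A -> balanced A ->
  \sum_i d 0 i != 0 -> is_absorption_inverse (laplacian A) d X ->
  forall k m, (X *m laplacian A) k m = (k == m)%:R - d 0 m / \sum_i d 0 i.
Proof.
(* Shifting the basis vector [e_m] by the constant [d_m / s] makes the entries of [D y] sum to 0,
   while [L] does not see the shift. *)
move=> A_ge0 connA balA s_neq0 [XL _] k m; set s := \sum_i _ in s_neq0 *.
pose y : 'cV[F]_n := delta_mx m 0 - const_mx (d 0 m / s).
have yN : in_N10 (laplacian A) d y.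
  apply: range_laplacian => //.
  under eq_bigr => i _ do rewrite mul_diag_mx !mxE mulrBr.
  rewrite sumrB -mulr_suml -/s (bigD1 m) //= !eqxx mulr1 big1 => [|i /negPf->].
    by rewrite addr0 mulrCA divff // mulr1 subrr.
  by rewrite mulr0.
have := XL y yN; rewrite {1}/y mulmxBr -[_ *m const_mx _]mulmxA.
rewrite laplacian_mul_const // mulmx0 subr0 -colE => /matrixP/(_ k 0).
by rewrite !mxE andbT => <-.
Qed.

Section AbsorptionInverse.

Variables (F : realFieldType) (n : nat) (A : 'M[F]_n.+1) (d : 'rV[F]_n.+1).
Variable X : 'M[F]_n.+1.
Hypotheses (A_ge0 : nonneg_weights A) (connA : strongly_connected A).
Hypotheses (balA : balanced A) (d_gt0 : forall i, 0 < d 0 i).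
Hypothesis XP : is_absorption_inverse (laplacian A) d X.

Let s_gt0 : 0 < \sum_i d 0 i.
Proof.
by rewrite big_ord_recl ltr_pwDl // sumr_ge0 // => i _; apply: ltW.
Qed.

Let XLE :=
  absorption_inverse_mul_laplacian A_ge0 connA balA (lt0r_neq0 s_gt0) XP.

Lemma absorption_inverse_le_diag i j : X i j <= X i i.
Proof.
have := @laplacian_min _ _ A (- row i X) i A_ge0 connA.
move=> /(_ _ j); rewrite !mxE lerN2; apply => m m_neq_i.
rewrite mulNmx -row_mul mxE [row _ _ _ _]mxE XLE.
by rewrite eq_sym (negPf m_neq_i) sub0r opprK divr_ge0 ?ltW.
Qed.

Lemma absorption_inverse_diff_min i j k : X k i - X i i <= X k j - X i j.
Proof.
have := @laplacian_min _ _ A (row k X - row i X) i A_ge0 connA.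
move=> /(_ _ j); rewrite !mxE; apply => m m_neq_i.
rewrite mulmxBl -!row_mul; move: (XLE k m) (XLE i m).
rewrite [i == m]eq_sym (negPf m_neq_i) => Xkm Xim.
rewrite mxE [in X in _ <= X + _]mxE Xkm mxE.
(* The terms [d_m / s] of the two rows cancel, leaving [[k = m]]. *)
by rewrite [row _ _ _ _]mxE Xim sub0r opprK addrNK ler0n.
Qed.

Lemma absorption_inverse_le_max_diag i j : X i j <= max_diag X.
Proof.
apply: le_trans (absorption_inverse_le_diag i j) _.
exact: (le_bigmax _ (fun k => X k k) i).
Qed.

End AbsorptionInverse.

Theorem proposition10 (F : realFieldType) (n : nat) (A : 'M[F]_n.+1)
    (d : 'rV[F]_n.+1) (Ld : 'M[F]_n.+1)
    (A_ge0 : nonneg_weights A)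
    (A_connected : strongly_connected A)
    (A_balanced : balanced A)
    (d_gt0 : forall i, 0 < d 0 i)
    (LdP : is_absorption_inverse (laplacian A) d Ld) :
  directed_metric (absorption_distance Ld).
Proof.
have le_max :=
  absorption_inverse_le_max_diag A_ge0 A_connected A_balanced d_gt0 LdP.
have R_ge0 j i : 0 <= absorption_distance Ld j i.
  by rewrite /absorption_distance; case: ifP => // _; rewrite subr_ge0.
split=> // [i|j k i]; first by rewrite /absorption_distance eqxx.
have [->|k_neq_j] := eqVneq k j.
  by rewrite {1}/absorption_distance eqxx addr_ge0.
rewrite /absorption_distance (negPf k_neq_j).
have [->|_] := eqVneq i j; first by rewrite (negPf k_neq_j) add0r.
have [->|_] := eqVneq k i; first by rewrite addr0.
(* For distinct indices the claim is [X_ki + X_ij <= K + X_kj]; the difference bound gives it with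
   [X_ii] in place of [K]. *)
have := le_max i i.
have := absorption_inverse_diff_min A_ge0 A_connected A_balanced d_gt0 LdP i j k.
lra.
Qed.
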